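(* The minimal ribbonlength of the standard unknot diagram (a simple closed planar curve) is $\pi$; that is, among all embedded ribbon loops $\gamma$, the minimum of $\mathrm{Rib}(\gamma)=\mathrm{Length}(\gamma)/2$ is attained and equals $\pi$ (a length minimiser has $\mathrm{Length}(\gamma)=2\pi$).
   Context: A loop is a $C^1$ immersion $\gamma:S^1\to\mathbb R^2$, $S^1=[0,1]/\{0\sim1\}$, with derivative of constant norm; maps are identified with their images when convenient. For a closed interval $I\subset S^1$ with $\gamma(I)$ embedded, the medial axis of the arc $\gamma(I)$ is the locus of centres of maximal circles touching the arc (on either side) whose interiors are disjoint from the arc. $\gamma$ satisfies the separation bound on (a sufficiently small) $I$ if for every point $c$ on the medial axis of $\gamma|_I$, $\|\gamma(s)-c\|\ge1$ for all $s\in I$. Let $N(s)$ be a continuous choice of unit normal to $\gamma$ at $\gamma(s)$ and $\Gamma:S^1\times(-1,1)\to\mathbb R^2$, $\Gamma(s,t)=\gamma(s)+tN(s)$. A ribbon loop is a $C^1$ immersed loop satisfying the separation bound for a collection of closed intervals covering $S^1$ and the crossing condition, which requires in general that $\gamma$ and $\Gamma$ have only double points of self-intersection, and that all double points of $\Gamma$ come from neighbourhoods of crossing double points or crossing double intervals of $\gamma$. For an embedded loop $\gamma$ (no double points) the crossing condition thus amounts to $\Gamma$ being injective on $S^1\times(-1,1)$. *)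

(* Defs.v *)
From Stdlib Require Import Reals ZArith.
From Coquelicot Require Import Coquelicot.
Local Open Scope R_scope.

(** Coquelicot's norm on a product is [sqrt (norm x ^ 2 + norm y ^ 2)], so
    [norm] on [plane] is the Euclidean norm. *)
Definition plane : NormedModule R_AbsRing :=
  prod_NormedModule R_AbsRing R_NormedModule R_NormedModule.

Definition dist (x y : plane) : R := norm (minus x y).

Definition dot (x y : plane) : R := fst x * fst y + snd x * snd y.

(** Maps defined on [S^1 = [0,1]/{0~1}] are represented by 1-periodic maps
    on [R]; two reals represent the same point of [S^1] iff they differ by an
    integer. *)
Definition periodic (f : R -> plane) : Prop := forall s, f (s + 1) = f s.

Definition same_point (s s' : R) : Prop := exists k : Z, s' = s + IZR k.

(** Coquelicot's [Derive] is only for real-valued functions, hence the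
    coordinates; [is_loop] asks that this be the derivative of [g]. *)
Definition velocity (g : R -> plane) (s : R) : plane :=
  (Derive (fun u => fst (g u)) s, Derive (fun u => snd (g u)) s).

Definition is_loop (g : R -> plane) : Prop :=
  periodic g /\
  (forall s, is_derive g s (velocity g s)) /\
  (forall s, continuous (velocity g) s) /\
  (exists v, 0 < v /\ forall s, norm (velocity g s) = v).

Definition embedded_loop (g : R -> plane) : Prop :=
  is_loop g /\ forall s s', g s = g s' -> same_point s s'.

Definition length (g : R -> plane) : R :=
  RInt (fun s => norm (velocity g s)) 0 1.

(** The ribbon [t |-> g s + t N s], [-1 < t < 1], has width 2. *)
Definition Rib (g : R -> plane) : R := length g / 2.

(** The circle of centre [c] and radius [r] meets [A], and its interior is
    disjoint from [A]. *)
Definition touching_circle (A : plane -> Prop) (c : plane) (r : R) : Prop :=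
  0 < r /\
  (exists p, A p /\ dist p c = r) /\
  (forall p, A p -> ~ dist p c < r).

(** Maximality is with respect to inclusion of the open discs bounded by the
    circles. *)
Definition medial_axis (A : plane -> Prop) (c : plane) : Prop :=
  exists r, touching_circle A c r /\
    forall c' r', touching_circle A c' r' ->
      (forall x, dist x c < r -> dist x c' < r') ->
      c' = c /\ r' = r.

(** A closed interval of [S^1] is the projection of some [[a, b]] with
    [a < b < a + 1]. *)
Definition arc (g : R -> plane) (a b : R) (p : plane) : Prop :=
  exists s, a <= s <= b /\ g s = p.

Definition embedded_arc (g : R -> plane) (a b : R) : Prop :=
  forall s s', a <= s <= b -> a <= s' <= b -> g s = g s' -> s = s'.

Definition separation_bound (g : R -> plane) (a b : R) : Prop :=
  forall c, medial_axis (arc g a b) c ->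
    forall s, a <= s <= b -> 1 <= dist (g s) c.

(** [J a b] means that the interval [[a, b]] belongs to the collection. *)
Definition covering_separation_bound (g : R -> plane) : Prop :=
  exists J : R -> R -> Prop,
    (forall a b, J a b ->
       a < b < a + 1 /\ embedded_arc g a b /\ separation_bound g a b) /\
    (forall s, exists a b s', J a b /\ same_point s s' /\ a <= s' <= b).

Definition unit_normal_field (g N : R -> plane) : Prop :=
  periodic N /\
  (forall s, continuous N s) /\
  (forall s, norm (N s) = 1) /\
  (forall s, dot (velocity g s) (N s) = 0).

Definition ribbon_map (g N : R -> plane) (s t : R) : plane :=
  plus (g s) (scal t (N s)).

(** There are exactly two continuous unit normal fields, [N] and [- N], and
    replacing one by the other only changes [t] into [- t]; the choice is
    therefore immaterial. *)
Definition embedded_crossing_condition (g : R -> plane) : Prop :=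
  exists N, unit_normal_field g N /\
    forall s t s' t', -1 < t < 1 -> -1 < t' < 1 ->
      ribbon_map g N s t = ribbon_map g N s' t' ->
      same_point s s' /\ t = t'.

Definition embedded_ribbon_loop (g : R -> plane) : Prop :=
  embedded_loop g /\
  covering_separation_bound g /\
  embedded_crossing_condition g.

(* Main.v *)
Require Import Defs.
From Stdlib Require Import Reals ZArith Lra Psatz.
From Coquelicot Require Import Coquelicot.
(* [Reals] also exports a [dist]; the one of the plane is meant below. *)
Import Defs.
Local Open Scope R_scope.

(** The lower bound is a curvature estimate followed by Fenchel's theorem. Let
    the loop have speed [v], hence length [v]. Injectivity of the ribbon map
    implies that the two open discs of radius one tangent to the loop at any
    of its points do not meet the loop ([tangent_discs_avoid_loop]): the
    nearest point of the loop to [g s + t N s], [|t| < 1], can only be [g s].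
    Applied at both ends of a short chord, this says that the loop turns no
    more along the chord than the unit circle does along a chord of the same
    length ([turning_by_chord]). So the curvature is at most one, in the sense
    that the tangent turns at rate at most [x] for each [x > v]
    ([local_turning], [global_turning]). A closed curve whose tangent turns at
    rate at most [x] over one period satisfies [2 PI <= x]
    ([total_turning_ge]), and hence [2 PI <= v]. The tangent of a C^1 loop
    need not be differentiable, so turning is measured by inner products of
    unit tangents compared with cosines, not by a curvature function.

    The bound is attained by the unit circle.  Its ribbon consists of concentric
    circles, so the crossing condition is immediate.  For the separation bound
    it is covered by arcs of a quarter turn: a circle of radius less than one
    touching such an arc is not maximal, because the homothety about the
    touching point that brings the radius to one keeps it off the arc
    ([medial_axis_short_arc]).

    A length minimiser is no longer than the unit circle, hence has length
    [2 PI]. *)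

(** * The Euclidean plane *)

Definition cross (p q : plane) : R := fst p * snd q - snd p * fst q.

Lemma norm_sqr (p : plane) : norm p ^ 2 = dot p p.
Proof.
  destruct p as [a b]; unfold dot; cbn; unfold prod_norm; cbn.
  unfold abs; cbn.
  rewrite !Rmult_1_r, sqrt_sqrt.
  - rewrite <- !Rabs_mult, !Rabs_pos_eq; nra.
  - pose proof (Rle_0_sqr (Rabs a)); pose proof (Rle_0_sqr (Rabs b)).
    unfold Rsqr in *; lra.
Qed.

Lemma dist_sqr (p q : plane) : dist p q ^ 2 = dot (minus p q) (minus p q).
Proof. apply norm_sqr. Qed.

Lemma dist_ge0 (p q : plane) : 0 <= dist p q.
Proof. apply norm_ge_0. Qed.

Lemma dist_triangle (p q r : plane) : dist p r <= dist p q + dist q r.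
Proof.
  unfold dist.
  replace (minus p r) with (plus (minus p q) (minus q r)).
  - apply (norm_triangle (V := plane)).
  - unfold minus.
    now rewrite <- plus_assoc, (plus_assoc (opp q)), plus_opp_l, plus_zero_l.
Qed.

Lemma plane_eq (p q : plane) :
  fst p - fst q = 0 -> snd p - snd q = 0 -> p = q.
Proof.
  destruct p, q; cbn; intros H1 H2.
  now rewrite (Rminus_diag_uniq _ _ H1), (Rminus_diag_uniq _ _ H2).
Qed.

Lemma minus_coord (p q : plane) : minus p q = (fst p - fst q, snd p - snd q).
Proof. destruct p, q; reflexivity. Qed.

Lemma ribbon_map_coord (g N : R -> plane) (s t : R) :
  ribbon_map g N s t = (fst (g s) + t * fst (N s), snd (g s) + t * snd (N s)).
Proof. reflexivity. Qed.

Lemma dot_self_ge0 (p : plane) : 0 <= dot p p.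
Proof. unfold dot; nra. Qed.

(** * Differentiable curves *)

Lemma is_derive_fst (g : R -> plane)
    (diff_g : forall s, is_derive g s (velocity g s)) s :
  is_derive (fun u => fst (g u)) s (fst (velocity g s)).
Proof.
  apply (filterdiff_comp' g fst s _ (fun p => fst p) (diff_g s)).
  apply filterdiff_linear, is_linear_fst.
Qed.

Lemma is_derive_snd (g : R -> plane)
    (diff_g : forall s, is_derive g s (velocity g s)) s :
  is_derive (fun u => snd (g u)) s (snd (velocity g s)).
Proof.
  apply (filterdiff_comp' g snd s _ (fun p => snd p) (diff_g s)).
  apply filterdiff_linear, is_linear_snd.
Qed.

Lemma is_derive_dot (g : R -> plane)
    (diff_g : forall s, is_derive g s (velocity g s)) (m : plane) s :
  is_derive (fun u => dot (g u) m) s (dot (velocity g s) m).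
Proof.
  pose proof (is_derive_fst g diff_g s) as Hx.
  pose proof (is_derive_snd g diff_g s) as Hy.
  unfold dot.
  apply (is_derive_plus (fun u => fst (g u) * fst m)
                        (fun u => snd (g u) * snd m)).
  - apply (is_derive_ext (fun u => scal (fst m) (fst (g u)))).
    + intros; apply Rmult_comm.
    + rewrite Rmult_comm; now apply (is_derive_scal (fun u => fst (g u))).
  - apply (is_derive_ext (fun u => scal (snd m) (snd (g u)))).
    + intros; apply Rmult_comm.
    + rewrite Rmult_comm; now apply (is_derive_scal (fun u => snd (g u))).
Qed.

Lemma is_derive_dist_sqr (g : R -> plane)
    (diff_g : forall s, is_derive g s (velocity g s)) (p : plane) s :
  is_derive (fun u => dot (minus (g u) p) (minus (g u) p)) s
    (2 * dot (velocity g s) (minus (g s) p)).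
Proof.
  pose proof (is_derive_fst g diff_g s) as Hx.
  pose proof (is_derive_snd g diff_g s) as Hy.
  rewrite minus_coord.
  unfold dot; cbn [fst snd].
  apply (is_derive_ext (fun u => (fst (g u) - fst p) ^ 2
                                 + (snd (g u) - snd p) ^ 2)).
  - intros t; rewrite minus_coord; cbn; ring.
  - evar_last.
    + apply (is_derive_plus (fun u => (fst (g u) - fst p) ^ 2)
                            (fun u => (snd (g u) - snd p) ^ 2)).
      * apply (is_derive_pow (fun u => fst (g u) - fst p)).
        apply (is_derive_minus (fun u => fst (g u)) (fun _ => fst p)).
        -- exact Hx.
        -- apply is_derive_const.
      * apply (is_derive_pow (fun u => snd (g u) - snd p)).
        apply (is_derive_minus (fun u => snd (g u)) (fun _ => snd p)).
        -- exact Hy.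
        -- apply is_derive_const.
    + cbv [plus minus opp zero]; cbn; cbv [opp]; cbn. ring.
Qed.

Lemma mean_value_dot (g : R -> plane)
    (diff_g : forall s, is_derive g s (velocity g s)) (m : plane) a b :
  a < b ->
  exists c, a <= c <= b /\
    dot (minus (g b) (g a)) m = dot (velocity g c) m * (b - a).
Proof.
  intros Hab.
  destruct (MVT_gen (fun u => dot (g u) m) a b (fun u => dot (velocity g u) m))
    as [c [Hc E]].
  - intros; apply is_derive_dot, diff_g.
  - intros x _; apply continuity_pt_filterlim.
    apply (ex_derive_continuous (fun u => dot (g u) m)).
    eexists; apply is_derive_dot, diff_g.
  - rewrite Rmin_left, Rmax_right in Hc by lra.
    exists c; split; [exact Hc|].
    rewrite <- E; rewrite minus_coord; unfold dot; cbn; ring.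
Qed.

Lemma periodic_shift (f : R -> plane) (k : Z) s :
  periodic f -> f (s + IZR k) = f s.
Proof.
  intros Hf.
  assert (Hn : forall n : nat, forall u, f (u + INR n) = f u).
  { induction n as [|n IH]; intros u.
    - cbn; now rewrite Rplus_0_r.
    - rewrite S_INR, <- Rplus_assoc, Hf; apply IH. }
  destruct (Z_le_gt_dec 0 k) as [Hk|Hk].
  - rewrite <- (Z2Nat.id k Hk), <- INR_IZR_INZ; apply Hn.
  - rewrite <- (Hn (Z.to_nat (- k)) (s + IZR k)), INR_IZR_INZ, Z2Nat.id by lia.
    rewrite opp_IZR; f_equal; lra.
Qed.

Lemma velocity_periodic (g : R -> plane) : periodic g -> periodic (velocity g).
Proof.
  intros Hg s; unfold velocity.
  assert (H : forall f : R -> R, (forall u, f (u + 1) = f u) ->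
            Derive f (s + 1) = Derive f s).
  { intros f Hf; unfold Derive; f_equal; apply Lim_ext; intros h.
    replace (s + 1 + h) with (s + h + 1) by ring; now rewrite !Hf. }
  f_equal; apply H; intros u; now rewrite Hg.
Qed.

Lemma length_const_speed (g : R -> plane) v :
  (forall s, norm (velocity g s) = v) -> length g = v.
Proof.
  intros H; unfold length.
  rewrite (RInt_ext _ (fun _ => v)) by (intros; apply H).
  rewrite RInt_const; unfold scal; cbn; unfold mult; cbn; lra.
Qed.

Lemma Rabs_case (x : R) : Rabs x = x \/ Rabs x = - x.
Proof. unfold Rabs; destruct (Rcase_abs x); auto. Qed.

(** * Tangent discs of radius one *)

Lemma reduce_mod_one (s : R) : exists k : Z, 0 <= s + IZR k <= 1.
Proof.
  exists (1 - up s)%Z; rewrite minus_IZR.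
  destruct (archimed s); lra.
Qed.

(** By periodicity a minimum over [[0, 1]] of the squared distance to [p] is a
    minimum over the whole line, hence a critical point. *)
Lemma nearest_point (g : R -> plane) (p : plane) :
  is_loop g ->
  exists u, (forall s, dist (g u) p <= dist (g s) p) /\
    dot (velocity g u) (minus (g u) p) = 0.
Proof.
  intros [Hper [Hd _]].
  set (f := fun u => dot (minus (g u) p) (minus (g u) p)).
  assert (Hf : forall s, derivable_pt_lim f s
                 (2 * dot (velocity g s) (minus (g s) p))).
  { intros s; apply is_derive_Reals; now apply is_derive_dist_sqr. }
  destruct (continuity_ab_min f 0 1) as [u [Hu Hu01]]; [lra| |].
  { intros c _; apply derivable_continuous_pt.
    eexists; apply Hf. }
  assert (Hmin : forall s, f u <= f s).
  { intros s; destruct (reduce_mod_one s) as [k Hk].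
    specialize (Hu _ Hk); unfold f in *.
    now rewrite (periodic_shift g k s Hper) in Hu. }
  exists u; split.
  - intros s.
    apply Rsqr_incr_0; try apply dist_ge0.
    rewrite !Rsqr_pow2, !dist_sqr; apply Hmin.
  - pose (pr := exist _ _ (Hf u) : derivable_pt f u).
    assert (H : derive_pt f u pr = 0)
      by (apply (deriv_minimum f (u - 1) (u + 1));
          [lra|lra|intros; apply Hmin]).
    unfold derive_pt in H; cbn [proj1_sig pr] in H; lra.
Qed.

(** In the plane, a vector orthogonal to [z <> 0] is a multiple of any unit
    vector [n] orthogonal to [z]. *)
Lemma normal_component (n w z : plane) :
  dot n n = 1 -> dot z n = 0 -> z <> (0, 0) -> dot z w = 0 ->
  dot w n * fst n = fst w /\ dot w n * snd n = snd w.
Proof.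
  destruct n as [n1 n2], w as [w1 w2], z as [z1 z2].
  change R in n1, n2, w1, w2, z1, z2; unfold dot; cbn.
  intros Hn Hzn Hz Hzw.
  assert (Hz2 : 0 < z1 ^ 2 + z2 ^ 2).
  { destruct (Req_dec z1 0) as [->|H1]; [|nra].
    destruct (Req_dec z2 0) as [->|H2]; [|nra].
    now elim Hz. }
  assert (Hc : w1 * n2 - w2 * n1 = 0).
  { apply (Rmult_eq_reg_l (z1 ^ 2 + z2 ^ 2)); [|lra].
    transitivity ((z1 * n2 - z2 * n1) * (z1 * w1 + z2 * w2)
                  - (z1 * w2 - z2 * w1) * (z1 * n1 + z2 * n2)
                  ); [ring|rewrite Hzn, Hzw; ring]. }
  split.
  - transitivity (w1 * (n1 * n1 + n2 * n2) - n2 * (w1 * n2 - w2 * n1));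
      [ring|rewrite Hn, Hc; ring].
  - transitivity (w2 * (n1 * n1 + n2 * n2) + n1 * (w1 * n2 - w2 * n1));
      [ring|rewrite Hn, Hc; ring].
Qed.

(** The conclusion says that the open discs of radius one with centres
    [g s + N s] and [g s - N s] contain no point of the loop.  Indeed the point
    [g s + t N s] of the ribbon has a nearest point [g u] on the loop, at
    distance at most [|t| < 1] and in a direction normal to the loop; it is
    therefore also [g u + t1 N u] with [|t1| < 1], and injectivity of the ribbon
    map forces [t1 = t].  So its distance to the loop is exactly [|t|], and it
    remains to let [t] tend to 1 and to -1. *)
Lemma tangent_discs_avoid_loop (g N : R -> plane) :
  is_loop g -> unit_normal_field g N ->
  (forall s t s' t', -1 < t < 1 -> -1 < t' < 1 ->
     ribbon_map g N s t = ribbon_map g N s' t' -> same_point s s' /\ t = t') ->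
  forall s s',
    2 * Rabs (dot (minus (g s') (g s)) (N s))
    <= dot (minus (g s') (g s)) (minus (g s') (g s)).
Proof.
  intros Hloop (_ & _ & HN1 & HNV) Hinj s s'.
  assert (HN : forall u, dot (N u) (N u) = 1).
  { intros u; rewrite <- norm_sqr, HN1; ring. }
  set (w := minus (g s') (g s)).
  assert (Hball : forall t, -1 < t < 1 -> 2 * (t * dot w (N s)) <= dot w w).
  { intros t Ht.
    set (p := ribbon_map g N s t).
    destruct (nearest_point g p Hloop) as [u [Hmin Hnormal]].
    assert (Hp : forall q, dot (minus q p) (minus q p) =
              dot (minus q (g s)) (minus q (g s))
              - 2 * t * dot (minus q (g s)) (N s) + t ^ 2).
    { intros q; rewrite <- (Rmult_1_r (t ^ 2)), <- (HN s).
      unfold p; rewrite !minus_coord, ribbon_map_coord; unfold dot; cbn; ring. }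
    assert (Hmin2 : forall x, dot (minus (g u) p) (minus (g u) p)
                         <= dot (minus (g x) p) (minus (g x) p)).
    { intros x; rewrite <- !dist_sqr; apply pow_incr; split;
        [apply dist_ge0|apply Hmin]. }
    assert (Hs : dot (minus (g s) p) (minus (g s) p) = t ^ 2).
    { rewrite Hp, !minus_coord; unfold dot; cbn; ring. }
    assert (HV0 : velocity g u <> (0, 0)).
    { destruct Hloop as (_ & _ & _ & v & Hv & Hspeed).
      intros E; specialize (Hspeed u).
      pose proof (norm_sqr (velocity g u)) as Hn.
      rewrite Hspeed, E in Hn; unfold dot in Hn; cbn in Hn; nra. }
    destruct (normal_component (N u) (minus (g u) p) (velocity g u)
                    (HN u) (HNV u) HV0 Hnormal) as [E1 E2].
    set (t' := dot (minus (g u) p) (N u)) in *.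
    assert (Ht' : dot (minus (g u) p) (minus (g u) p) = t' ^ 2).
    { transitivity (t' ^ 2 * dot (N u) (N u)); [|rewrite HN; ring].
      unfold dot; rewrite <- E1, <- E2; ring. }
    assert (Hle : t' ^ 2 <= t ^ 2) by (rewrite <- Ht', <- Hs; apply Hmin2).
    destruct (Hinj s t u (- t')) as [_ E].
    - exact Ht.
    - split; nra.
    - fold p; rewrite ribbon_map_coord.
      rewrite minus_coord in E1, E2; cbn [fst snd] in E1, E2.
      apply plane_eq; cbn [fst snd]; lra.
    - specialize (Hmin2 s'); rewrite Ht', Hp in Hmin2; fold w in Hmin2.
      replace (t' ^ 2) with (t ^ 2) in Hmin2 by (rewrite E; ring).
      lra. }
  assert (Hw0 := dot_self_ge0 w).
  set (d := dot w (N s)) in *; set (D := dot w w) in *.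
  (* If [D < 2 |d|], then [Hball] fails at each [t] strictly between
     [D / (2 |d|)] and 1, up to the sign of [d]. *)
  apply Rnot_lt_le; intros Hlt.
  assert (Hd : 0 < Rabs d) by lra.
  set (t := (D / (2 * Rabs d) + 1) / 2).
  assert (Hq : D / (2 * Rabs d) * (2 * Rabs d) = D) by (field; lra).
  assert (Hq0 : 0 <= D / (2 * Rabs d)).
  { apply Rdiv_le_0_compat; lra. }
  assert (Hq1 : D / (2 * Rabs d) < 1) by nra.
  assert (Ht : 2 * (t * Rabs d) <= D).
  { destruct (Rabs_case d) as [->| ->].
    - apply Hball; unfold t; lra.
    - replace (2 * (t * - d)) with (2 * (- t * d)) by ring.
      apply Hball; unfold t; lra. }
  unfold t in Ht; nra.
Qed.

(** * Turning of the tangent *)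

Lemma mul_ge_of_sqr_ge (x y m : R) :
  0 <= x -> 0 <= y -> m <= x ^ 2 -> m <= y ^ 2 -> m <= x * y.
Proof.
  intros Hx Hy Hmx Hmy; destruct (Rle_dec x y); nra.
Qed.

(** Here [w] is a chord of the loop, and [z], [z'] are the velocities at its
    ends.  The two bounds on the cross products say that the angle between [w]
    and each tangent is at most [asin (|w| / 2)], as it is for a chord of the
    unit circle; so the tangent turns along the chord by at most
    [2 asin (|w| / 2)], whose cosine is [1 - |w|^2 / 2]. *)
Lemma turning_by_chord (w z z' : plane) v :
  0 < v -> dot z z = v ^ 2 -> dot z' z' = v ^ 2 ->
  0 < dot w z -> 0 < dot w z' ->
  2 * Rabs (cross w z) <= v * dot w w ->
  2 * Rabs (cross w z') <= v * dot w w ->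
  v ^ 2 * (1 - dot w w / 2) <= dot z z'.
Proof.
  intros Hv Hz Hz' Hwz Hwz' Hc Hc'.
  assert (HD : 0 < dot w w).
  { destruct (dot_self_ge0 w) as [|E]; [assumption|].
    exfalso; unfold dot in *; assert (fst w = 0) by nra;
    assert (snd w = 0) by nra; nra. }
  set (D := dot w w) in *.
  assert (L : forall q, dot q q = v ^ 2 ->
            dot w q ^ 2 + cross w q ^ 2 = v ^ 2 * D).
  { intros q <-; unfold D, dot, cross; ring. }
  assert (P : dot z z' * D = dot w z * dot w z' + cross w z * cross w z').
  { unfold D, dot, cross; ring. }
  assert (S : forall c, 2 * Rabs c <= v * D -> c ^ 2 <= v ^ 2 * D * D / 4
                                     /\ - (v * D) <= 2 * c <= v * D).
  { intros c H.
    assert (-(v * D) <= 2 * c <= v * D)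
      by (unfold Rabs in H; destruct (Rcase_abs c); lra).
    split; [nra|assumption]. }
  destruct (S _ Hc) as [Q1 Q2], (S _ Hc') as [Q3 Q4].
  assert (M : v ^ 2 * D - v ^ 2 * D * D / 4 <= dot w z * dot w z').
  { pose proof (L z Hz); pose proof (L z' Hz').
    apply mul_ge_of_sqr_ge; lra. }
  assert (C : - (v ^ 2 * D * D / 4) <= cross w z * cross w z') by nra.
  apply (Rmult_le_reg_r D); [assumption|].
  rewrite P; lra.
Qed.

Lemma cross_normal (w z n : plane) v :
  0 < v -> dot z z = v ^ 2 -> dot n n = 1 -> dot z n = 0 ->
  Rabs (cross w z) = v * Rabs (dot w n).
Proof.
  intros Hv Hz Hn Hzn.
  rewrite <- (Rabs_pos_eq v), <- Rabs_mult by lra.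
  apply Rsqr_eq_abs_0; unfold Rsqr.
  assert (E : v * v = (cross z n) ^ 2).
  { transitivity (dot z z * dot n n - (dot z n) ^ 2).
    - rewrite Hz, Hn, Hzn; ring.
    - unfold cross, dot; ring. }
  transitivity ((v * v) * (dot w n * dot w n)); [|ring].
  rewrite E.
  assert (F : cross w z * dot n n = - (cross z n) * dot w n
                                    + cross w n * dot z n).
  { unfold cross, dot; ring. }
  rewrite Hn, Hzn in F.
  replace (cross w z) with (- (cross z n) * dot w n) by lra; ring.
Qed.

(** The triangle inequality for angles, written with cosines so that no angle
    function along the loop has to be chosen. *)
Lemma angle_triangle (p q r : plane) a b :
  dot p p = 1 -> dot q q = 1 -> dot r r = 1 ->
  0 <= a -> 0 <= b -> a + b <= PI ->
  cos a <= dot p q -> cos b <= dot q r -> cos (a + b) <= dot p r.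
Proof.
  intros Hp Hq Hr Ha Hb Hab Hpq Hqr.
  assert (L : forall x y, dot x x = 1 -> dot y y = 1 ->
            dot x y ^ 2 + cross x y ^ 2 = 1).
  { intros x y Hx Hy; transitivity (dot x x * dot y y);
      [unfold dot, cross; ring|rewrite Hx, Hy; ring]. }
  assert (A : forall x y c, dot x x = 1 -> dot y y = 1 -> 0 <= c <= PI ->
            cos c <= dot x y ->
            exists c', 0 <= c' <= c /\ dot x y = cos c'
              /\ (sin c') ^ 2 = cross x y ^ 2 /\ 0 <= sin c').
  { intros x y c Hx Hy Hc Hxy; specialize (L x y Hx Hy).
    assert (-1 <= dot x y <= 1) by (split; nra).
    pose proof (acos_bound (dot x y)).
    exists (acos (dot x y)).
    assert (E : cos (acos (dot x y)) = dot x y) by now apply cos_acos.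
    split; [split|split; [|split]]; try lra.
    - apply cos_decr_0; lra.
    - pose proof (sin2_cos2 (acos (dot x y))) as T; unfold Rsqr in T.
      rewrite E in T; lra.
    - apply sin_ge_0; lra. }
  destruct (A p q a) as (a' & Ha' & Ea & Sa & Sa0); try lra.
  destruct (A q r b) as (b' & Hb' & Eb & Sb & Sb0); try lra.
  apply Rle_trans with (cos (a' + b')).
  - apply cos_decr_1; lra.
  - rewrite cos_plus, <- Ea, <- Eb.
    assert (E : dot p r = dot p q * dot q r - cross p q * cross q r).
    { transitivity (dot p r * dot q q); [rewrite Hq; ring|].
      unfold dot, cross; ring. }
    rewrite E.
    enough (cross p q * cross q r <= sin a' * sin b') by lra.
    apply Rsqr_incr_0_var; [|now apply Rmult_le_pos].
    rewrite !Rsqr_mult, !Rsqr_pow2, Sa, Sb; lra.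
Qed.

Lemma chord_le_arc (g : R -> plane) v a b :
  is_loop g -> 0 < v -> (forall s, norm (velocity g s) = v) -> a < b ->
  dot (minus (g b) (g a)) (minus (g b) (g a)) <= (v * (b - a)) ^ 2.
Proof.
  intros (_ & Hd & _) Hv Hspeed Hab.
  set (w := minus (g b) (g a)).
  destruct (mean_value_dot g Hd w a b Hab) as [c [_ E]]; fold w in E.
  assert (Hw := dot_self_ge0 w).
  assert (HV : dot (velocity g c) (velocity g c) = v ^ 2)
    by now rewrite <- norm_sqr, Hspeed.
  assert (CS : dot (velocity g c) w ^ 2 <= v ^ 2 * dot w w).
  { rewrite <- HV.
    enough (0 <= cross (velocity g c) w ^ 2) as H
      by (revert H; unfold cross, dot; intros; lra).
    apply pow2_ge_0. }
  destruct (Req_dec (dot w w) 0) as [->|H0]; [apply pow2_ge_0|].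
  apply (Rmult_le_reg_r (dot w w)); [lra|].
  assert (H1 : 0 < (b - a) ^ 2) by (apply pow_lt; lra).
  replace (dot w w * dot w w) with (dot (velocity g c) w ^ 2 * (b - a) ^ 2)
    by (rewrite E; ring).
  nra.
Qed.

(** The slack between [v] and [x] absorbs the error of comparing the chord bound
    [1 - (v h)^2 / 2] with a cosine. *)
Lemma cos_le_parabola (x v : R) :
  0 < v < x -> exists d, 0 < d /\
    forall h, 0 < h < d -> cos (x * h) <= 1 - (v * h) ^ 2 / 2.
Proof.
  intros Hv.
  assert (He : 0 < 1 - v / x).
  { enough (v / x < 1) by lra. apply Rlt_div_l; lra. }
  destruct (derivable_pt_lim_sin 0 _ He) as [d Hd].
  exists (2 * d / x); split.
  - pose proof (cond_pos d); apply Rdiv_lt_0_compat; lra.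
  - intros h Hh.
    set (y := x * h / 2).
    assert (Hy : 0 < y) by (unfold y; nra).
    assert (Hyd : y < d).
    { unfold y. destruct Hh as [_ Hh]. apply Rlt_div_r in Hh; lra. }
    specialize (Hd y).
    rewrite Rabs_pos_eq in Hd by lra.
    assert (Hs := Hd ltac:(lra) Hyd).
    rewrite Rplus_0_l, sin_0, cos_0, Rminus_0_r in Hs.
    apply Rabs_def2 in Hs; destruct Hs as [_ Hs].
    assert (Hs' : v / x < sin y / y) by lra.
    apply Rlt_div_r in Hs'; [|lra].
    replace (v / x * y) with (v * h / 2) in Hs' by (unfold y; field; lra).
    replace (x * h) with (2 * y) by (unfold y; field).
    rewrite cos_2a_sin.
    assert (0 < v * h) by nra.
    nra.
Qed.

Lemma velocity_uniformly_continuous (g : R -> plane) e :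
  is_loop g -> 0 < e ->
  exists d, 0 < d /\ forall s s', 0 <= s <= 1 -> 0 <= s' <= 1 ->
    Rabs (s - s') < d ->
    Rabs (fst (velocity g s) - fst (velocity g s')) < e /\
    Rabs (snd (velocity g s) - snd (velocity g s')) < e.
Proof.
  intros (_ & _ & Hc & _) He.
  assert (C1 : forall x, 0 <= x <= 1 ->
            continuity_pt (fun s => fst (velocity g s)) x).
  { intros x _; apply continuity_pt_filterlim.
    apply (continuous_comp (velocity g) fst); [apply Hc|].
    destruct (velocity g x); apply continuous_fst. }
  assert (C2 : forall x, 0 <= x <= 1 ->
            continuity_pt (fun s => snd (velocity g s)) x).
  { intros x _; apply continuity_pt_filterlim.
    apply (continuous_comp (velocity g) snd); [apply Hc|].
    destruct (velocity g x); apply continuous_snd. }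
  destruct (Heine_cor2 C1 (mkposreal e He)) as [d1 H1].
  destruct (Heine_cor2 C2 (mkposreal e He)) as [d2 H2].
  exists (Rmin d1 d2); split.
  - apply Rmin_glb_lt; apply cond_pos.
  - intros s s' Hs Hs' Hd; split.
    + apply H1; auto. eapply Rlt_le_trans; [exact Hd|apply Rmin_l].
    + apply H2; auto. eapply Rlt_le_trans; [exact Hd|apply Rmin_r].
Qed.

Definition unit_tangent (g : R -> plane) (v : R) (s : R) : plane :=
  (fst (velocity g s) / v, snd (velocity g s) / v).

Lemma dot_unit_tangent g v s s' :
  0 < v ->
  dot (unit_tangent g v s) (unit_tangent g v s')
  = dot (velocity g s) (velocity g s') / v ^ 2.
Proof. intros; unfold dot, unit_tangent; cbn; field; lra. Qed.

(** The curvature bound: for each rate [x] greater than the speed [v], the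
    tangent turns at rate at most [x] over all short time intervals.  The discs
    of radius one tangent to the loop at the two ends of a chord control the
    angles between the chord and the tangents there; uniform continuity of the
    velocity makes these angles acute, so that their sines determine them. *)
Lemma local_turning (g N : R -> plane) v x :
  is_loop g -> unit_normal_field g N ->
  (forall s s',
    2 * Rabs (dot (minus (g s') (g s)) (N s))
    <= dot (minus (g s') (g s)) (minus (g s') (g s))) ->
  (forall s, norm (velocity g s) = v) -> 0 < v < x ->
  exists d, 0 < d /\ forall s h, 0 <= s -> s + h <= 1 -> 0 <= h < d ->
    cos (x * h) <= dot (unit_tangent g v s) (unit_tangent g v (s + h)).
Proof.
  intros Hloop (_ & _ & HN1 & HNV) Hdisc Hspeed Hv.
  assert (HV : forall s, dot (velocity g s) (velocity g s) = v ^ 2)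
    by (intros; now rewrite <- norm_sqr, Hspeed).
  assert (HN : forall u, dot (N u) (N u) = 1)
    by (intros u; rewrite <- norm_sqr, HN1; ring).
  destruct (velocity_uniformly_continuous g (v / 2) Hloop) as [d1 [Hd1 H1]];
    [lra|].
  destruct (cos_le_parabola x v Hv) as [d2 [Hd2 H2]].
  exists (Rmin d1 d2); split; [now apply Rmin_glb_lt|].
  intros s h Hs Hsh [Hh Hd].
  assert (h < d1 /\ h < d2) as [Hh1 Hh2].
  { split; eapply Rlt_le_trans; try exact Hd; [apply Rmin_l|apply Rmin_r]. }
  rewrite dot_unit_tangent by lra.
  destruct Hh as [Hh|<-].
  2: { rewrite Rplus_0_r, Rmult_0_r, cos_0, HV; right; field; lra. }
  set (w := minus (g (s + h)) (g s)).
  assert (Hacute : forall u u', s <= u <= s + h -> s <= u' <= s + h ->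
            0 < dot (velocity g u) (velocity g u')).
  { intros u u' Hu Hu'.
    destruct (H1 u u') as [A B]; try lra.
    { apply Rabs_def1; lra. }
    pose proof (HV u) as Eu; pose proof (HV u') as Eu'.
    unfold dot in *.
    apply Rabs_def2 in A; apply Rabs_def2 in B.
    nra. }
  assert (Hw : forall u, s <= u <= s + h -> 0 < dot w (velocity g u)).
  { intros u Hu.
    destruct (mean_value_dot g (proj1 (proj2 Hloop)) (velocity g u) s (s + h))
      as [c [Hc E]]; [lra|].
    fold w in E; rewrite E; apply Rmult_lt_0_compat; [|lra].
    now apply Hacute. }
  assert (Hcross : forall u, s <= u <= s + h ->
            2 * Rabs (dot w (N u)) <= dot w w ->
            2 * Rabs (cross w (velocity g u)) <= v * dot w w).
  { intros u Hu H.
    rewrite (cross_normal w (velocity g u) (N u) v) by (auto; lra).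
    nra. }
  assert (Hturn := turning_by_chord w (velocity g s) (velocity g (s + h)) v
    ltac:(lra) (HV s) (HV (s + h)) (Hw s ltac:(lra)) (Hw (s + h) ltac:(lra))).
  lapply Hturn; [clear Hturn; intros Hturn|apply Hcross; [lra|apply Hdisc]].
  lapply Hturn; [clear Hturn; intros Hturn|].
  2: { apply Hcross; [lra|].
    assert (E : forall q, dot (minus (g s) (g (s + h))) q = - dot w q).
    { intros q; unfold w; rewrite !minus_coord; unfold dot; cbn; ring. }
    specialize (Hdisc (s + h) s); rewrite !E, Rabs_Ropp in Hdisc.
    replace (dot w w) with (- dot w (minus (g s) (g (s + h)))); [exact Hdisc|].
    unfold w; rewrite !minus_coord; unfold dot; cbn; ring. }
  assert (Hchord := chord_le_arc g v s (s + h) Hloop (proj1 Hv) Hspeed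
                      ltac:(lra)).
  fold w in Hchord; replace (s + h - s) with h in Hchord by ring.
  apply Rle_div_r; [apply Rlt_gt, pow_lt; lra|].
  specialize (H2 h (conj Hh Hh2)).
  assert (0 < v ^ 2) by (apply pow_lt; lra).
  nra.
Qed.

Lemma turning_of_steps (T : R -> plane) x h s (n : nat) :
  (forall s, dot (T s) (T s) = 1) -> 0 <= x -> 0 <= h ->
  (forall k : nat, (k < n)%nat ->
     cos (x * h) <= dot (T (s + INR k * h)) (T (s + INR k * h + h))) ->
  x * (INR n * h) <= PI ->
  cos (x * (INR n * h)) <= dot (T s) (T (s + INR n * h)).
Proof.
  intros HT Hx Hh; induction n as [|n IH]; intros Hstep HPI.
  - cbn [INR]; rewrite Rmult_0_l, Rplus_0_r, Rmult_0_r, cos_0, HT; lra.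
  - rewrite S_INR in *.
    assert (Hxh : 0 <= x * h) by now apply Rmult_le_pos.
    replace (x * ((INR n + 1) * h)) with (x * (INR n * h) + x * h) in * by ring.
    replace (s + (INR n + 1) * h) with (s + INR n * h + h) by ring.
    apply (angle_triangle _ (T (s + INR n * h))); auto.
    + repeat apply Rmult_le_pos; auto; apply pos_INR.
    + apply IH; [|lra]. intros k Hk; apply Hstep; lia.
Qed.

Lemma global_turning (T : R -> plane) x d a b :
  (forall s, dot (T s) (T s) = 1) -> 0 <= x -> 0 < d ->
  (forall s h, 0 <= s -> s + h <= 1 -> 0 <= h < d ->
     cos (x * h) <= dot (T s) (T (s + h))) ->
  0 <= a -> a <= b -> b <= 1 -> x * (b - a) <= PI ->
  cos (x * (b - a)) <= dot (T a) (T b).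
Proof.
  intros HT Hx Hd Hloc Ha Hab Hb HPI.
  destruct (archimed_cor1 d Hd) as [n [Hn Hn0]].
  assert (HnR : 0 < INR n) by now apply lt_0_INR.
  set (h := (b - a) / INR n).
  assert (E : INR n * h = b - a) by (unfold h; field; lra).
  assert (Hh0 : 0 <= h) by (apply Rdiv_le_0_compat; lra).
  assert (Hhd : h < d).
  { apply Rle_lt_trans with (/ INR n); [|assumption].
    unfold h, Rdiv; rewrite <- (Rmult_1_l (/ INR n)) at 2.
    apply Rmult_le_compat_r; [left; now apply Rinv_0_lt_compat|lra]. }
  replace b with (a + INR n * h) at 2 by lra.
  rewrite <- E; apply turning_of_steps; auto; [|now rewrite E].
  intros k Hk; apply Hloc; auto.
  - pose proof (pos_INR k); nra.
  - assert (INR k + 1 <= INR n)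
      by (rewrite <- S_INR; apply le_INR; lia).
    nra.
Qed.

Lemma sum_cos_pos a b : 0 <= a -> 0 <= b -> a + b < PI -> 0 < cos a + cos b.
Proof.
  intros Ha Hb Hab; rewrite form1.
  apply Rmult_lt_0_compat; [|apply cos_gt_0; lra].
  apply Rmult_lt_0_compat; [lra|apply cos_gt_0; lra].
Qed.

(** Fenchel's argument.  If the tangent turned by less than [2 PI] in all, then
    on each of the two halves of the loop the angles from [T s] to [T 0] and to
    [T (1/2)] would add up to less than [PI].  Then [T s] would have a positive
    inner product with [m = T 0 + T (1/2)] at all times, and the loop, always
    progressing in the direction [m], could not close up. *)
Lemma total_turning_ge (g : R -> plane) v x d :
  is_loop g -> (forall s, norm (velocity g s) = v) ->
  0 < v -> 0 <= x -> 0 < d ->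
  (forall s h, 0 <= s -> s + h <= 1 -> 0 <= h < d ->
    cos (x * h) <= dot (unit_tangent g v s) (unit_tangent g v (s + h))) ->
  2 * PI <= x.
Proof.
  intros Hloop Hspeed Hv Hx Hd Hloc.
  apply Rnot_lt_le; intros Hlt.
  set (T := unit_tangent g v) in *.
  assert (HT : forall s, dot (T s) (T s) = 1).
  { intros s; unfold T; rewrite dot_unit_tangent by assumption.
    rewrite <- norm_sqr, Hspeed; field; lra. }
  assert (Hturn : forall a b, 0 <= a -> a <= b -> b <= 1 -> b <= a + 1 / 2 ->
            cos (x * (b - a)) <= dot (T a) (T b)).
  { intros a b Ha Hab Hb Hhalf; apply (global_turning T x d); auto; nra. }
  assert (T1 : T 1 = T 0).
  { unfold T, unit_tangent.
    now rewrite <- (Rplus_0_l 1), (velocity_periodic g (proj1 Hloop)). }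
  assert (Hsym : forall p q, dot p q = dot q p)
    by (intros; unfold dot; ring).
  set (m := plus (T 0) (T (1 / 2))).
  assert (Hm : forall q, dot q m = dot q (T 0) + dot q (T (1 / 2))).
  { intros q; unfold m, dot; cbn; unfold plus; cbn; ring. }
  assert (Hpos : forall s, 0 <= s <= 1 -> 0 < dot (T s) m).
  { intros s Hs; rewrite Hm.
    destruct (Rle_dec s (1 / 2)).
    - pose proof (Hturn 0 s); pose proof (Hturn s (1 / 2)).
      pose proof (sum_cos_pos (x * (s - 0)) (x * (1 / 2 - s))).
      rewrite (Hsym (T s) (T 0)); nra.
    - pose proof (Hturn (1 / 2) s); pose proof (Hturn s 1).
      pose proof (sum_cos_pos (x * (s - 1 / 2)) (x * (1 - s))).
      rewrite <- T1, (Hsym (T s) (T (1 / 2))); nra. }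
  destruct (mean_value_dot g (proj1 (proj2 Hloop)) m 0 1) as [c [Hc E]];
    [lra|].
  rewrite <- (Rplus_0_l 1), (proj1 Hloop) in E.
  specialize (Hpos c Hc).
  assert (E' : dot (velocity g c) m = v * dot (T c) m).
  { unfold T, unit_tangent, dot; cbn; field; lra. }
  rewrite E' in E.
  assert (E0 : dot (minus (g 0) (g 0)) m = 0)
    by (rewrite minus_coord; unfold dot; cbn; ring).
  rewrite E0 in E; nra.
Qed.

Lemma loop_length_ge (g : R -> plane) :
  is_loop g -> embedded_crossing_condition g -> 2 * PI <= length g.
Proof.
  intros Hloop (N & HN & Hinj).
  destruct (Hloop) as (_ & _ & _ & v & Hv & Hspeed).
  rewrite (length_const_speed g v Hspeed).
  apply Rnot_lt_le; intros Hlt.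
  set (x := (v + 2 * PI) / 2).
  destruct (local_turning g N v x) as [d [Hd Hloc]]; auto.
  - now apply tangent_discs_avoid_loop.
  - unfold x; lra.
  - assert (2 * PI <= x); [|unfold x in *; lra].
    apply (total_turning_ge g v x d); auto; unfold x; lra.
Qed.

(** * The unit circle *)

Definition angle_point (x : R) : plane := (cos x, sin x).

Definition unit_circle (s : R) : plane := angle_point (2 * PI * s).

Lemma angle_point_periodic x : angle_point (x + 2 * PI) = angle_point x.
Proof.
  unfold angle_point; apply plane_eq; cbn [fst snd].
  - rewrite cos_plus, cos_2PI, sin_2PI; ring.
  - rewrite sin_plus, cos_2PI, sin_2PI; ring.
Qed.

Lemma unit_circle_periodic : periodic unit_circle.
Proof.
  intros s; unfold unit_circle; rewrite <- (angle_point_periodic (2 * PI * s)).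
  f_equal; ring.
Qed.

Lemma norm_angle_point x : norm (angle_point x) = 1.
Proof.
  pose proof (norm_sqr (angle_point x)) as H.
  pose proof (norm_ge_0 (angle_point x)).
  pose proof (sin2_cos2 x) as E; unfold Rsqr in E.
  unfold dot in H; cbn [fst snd angle_point] in H.
  assert (norm (angle_point x) ^ 2 = 1) by lra. nra.
Qed.

Lemma is_derive_unit_circle s :
  is_derive unit_circle s
    (- (2 * PI) * sin (2 * PI * s), 2 * PI * cos (2 * PI * s)).
Proof.
  assert (Hc : is_derive (fun u => cos (2 * PI * u)) s
                 (- (2 * PI) * sin (2 * PI * s))).
  { auto_derive; [exact I|ring]. }
  assert (Hs : is_derive (fun u => sin (2 * PI * u)) s
                 (2 * PI * cos (2 * PI * s))).
  { auto_derive; [exact I|ring]. }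
  apply (filterdiff_comp'_2 (fun u => cos (2 * PI * u))
    (fun u => sin (2 * PI * u)) (fun a b : R_NormedModule => (a, b) : plane) s
    _ _ (fun a b => (a, b)) Hc Hs).
  apply filterdiff_linear, is_linear_prod;
    [apply is_linear_fst|apply is_linear_snd].
Qed.

Lemma velocity_unit_circle s :
  velocity unit_circle s
  = (- (2 * PI) * sin (2 * PI * s), 2 * PI * cos (2 * PI * s)).
Proof.
  unfold velocity, unit_circle, angle_point; cbn [fst snd].
  f_equal; apply is_derive_unique; auto_derive; try exact I; ring.
Qed.

Lemma continuous_pair (f h : R -> R) s :
  continuous f s -> continuous h s ->
  continuous (fun u => (f u, h u) : plane) s.
Proof.
  intros Hf Hh.
  apply (continuous_comp_2 f h (fun a b => (a, b) : plane)); auto.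
  apply (continuous_ext (fun p : plane => p)); [now intros []|].
  apply continuous_id.
Qed.

Lemma unit_circle_speed s : norm (velocity unit_circle s) = 2 * PI.
Proof.
  pose proof PI_RGT_0.
  pose proof (norm_sqr (velocity unit_circle s)) as E.
  pose proof (norm_ge_0 (velocity unit_circle s)).
  rewrite velocity_unit_circle in *.
  unfold dot in E; cbn [fst snd] in E.
  pose proof (sin2_cos2 (2 * PI * s)) as T; unfold Rsqr in T.
  apply Rsqr_inj; [assumption|lra|].
  rewrite !Rsqr_pow2, E.
  transitivity ((2 * PI) ^ 2 * (sin (2 * PI * s) * sin (2 * PI * s)
                 + cos (2 * PI * s) * cos (2 * PI * s))); [ring|].
  rewrite T; ring.
Qed.

Lemma unit_circle_loop : is_loop unit_circle.
Proof.
  split; [exact unit_circle_periodic|split; [|split]].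
  - intros s; rewrite velocity_unit_circle; apply is_derive_unit_circle.
  - intros s.
    apply (continuous_ext (fun s =>
      (- (2 * PI) * sin (2 * PI * s), 2 * PI * cos (2 * PI * s)) : plane)).
    { intros u; now rewrite velocity_unit_circle. }
    apply continuous_pair;
      apply (ex_derive_continuous (V := R_NormedModule)); auto_derive; exact I.
  - exists (2 * PI); split; [pose proof PI_RGT_0; lra|apply unit_circle_speed].
Qed.

Lemma unit_circle_injective s s' :
  unit_circle s = unit_circle s' -> same_point s s'.
Proof.
  intros E; unfold unit_circle, angle_point in E.
  injection E as Ec Es.
  assert (H1 : cos (2 * (PI * (s' - s))) = 1).
  { replace (2 * (PI * (s' - s))) with (2 * PI * s' - 2 * PI * s) by ring.
    rewrite cos_minus, Ec, Es.
    pose proof (sin2_cos2 (2 * PI * s')) as T; unfold Rsqr in T; lra. }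
  rewrite cos_2a_sin in H1.
  assert (H0 : sin (PI * (s' - s)) = 0) by nra.
  destruct (sin_eq_0_0 _ H0) as [k Hk].
  exists k; pose proof PI_RGT_0.
  assert (s' - s = IZR k) by (apply (Rmult_eq_reg_l PI); lra).
  lra.
Qed.

Lemma unit_circle_normal : unit_normal_field unit_circle unit_circle.
Proof.
  split; [exact unit_circle_periodic|split; [|split]].
  - intros s; apply continuous_pair;
      apply (ex_derive_continuous (V := R_NormedModule)); auto_derive; exact I.
  - intros s; apply norm_angle_point.
  - intros s; rewrite velocity_unit_circle.
    unfold dot, unit_circle, angle_point; cbn [fst snd]; ring.
Qed.

Lemma unit_circle_crossing : embedded_crossing_condition unit_circle.
Proof.
  exists unit_circle; split; [exact unit_circle_normal|].
  intros s t s' t' Ht Ht' E.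
  (* The ribbon consists of the concentric circles of radii [1 + t]. *)
  rewrite !ribbon_map_coord in E.
  unfold unit_circle in E; cbn [fst snd angle_point] in E.
  injection E as Ec Es.
  pose proof (sin2_cos2 (2 * PI * s)) as T.
  pose proof (sin2_cos2 (2 * PI * s')) as T'.
  unfold Rsqr in *.
  set (c := cos (2 * PI * s)) in *; set (c' := cos (2 * PI * s')) in *.
  set (z := sin (2 * PI * s)) in *; set (z' := sin (2 * PI * s')) in *.
  assert (E2 : (1 + t) ^ 2 = (1 + t') ^ 2).
  { transitivity ((c + t * c) ^ 2 + (z + t * z) ^ 2).
    - transitivity ((1 + t) ^ 2 * (z * z + c * c)); [rewrite T|]; ring.
    - rewrite Ec, Es.
      transitivity ((1 + t') ^ 2 * (z' * z' + c' * c')); [|rewrite T']; ring. }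
  assert (Et : t = t') by nra.
  split; [|exact Et].
  apply unit_circle_injective.
  unfold unit_circle, angle_point; fold c c' z z'.
  subst t'; apply plane_eq; cbn [fst snd]; nra.
Qed.

(** * Touching discs of a short circular arc *)

(** The power, with respect to the circle of radius [r] through [p] with centre
    [p + r u], of the point [q] of the unit circle at angle [2 h] from [p].  It
    is nonnegative iff [q] is outside the open disc, and in this form the radius
    [r] occurs only in the coefficients of [sin h] and [cos h]. *)
Lemma disc_power (x h r : R) (u : plane) :
  let p := angle_point x in
  let q := angle_point (x + 2 * h) in
  let c := (fst p + r * fst u, snd p + r * snd u) : plane in
  let A := dot u p in
  let B := cross p u in
  dot u u = 1 ->
  dot (minus q c) (minus q c) - r ^ 2
  = 4 * (sin h * (sin h * (1 + r * A) - r * B * cos h)).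
Proof.
  intros p q c A B Hu.
  pose proof (sin2_cos2 x) as T; pose proof (sin2_cos2 h) as T'.
  unfold Rsqr in *.
  subst p q c A B; unfold angle_point; rewrite minus_coord.
  rewrite cos_plus, sin_plus, cos_2a_sin, sin_2a.
  unfold dot, cross in *; cbn [fst snd] in *.
  destruct u as [u1 u2]; cbn [fst snd] in *.
  change R in u1, u2.
  set (c := cos x) in *; set (s := sin x) in *.
  set (k := cos h) in *; set (z := sin h) in *.
  transitivity (((c * (1 - 2 * z * z) - s * (2 * z * k) - c) ^ 2 +
    (s * (1 - 2 * z * z) + c * (2 * z * k) - s) ^ 2)
    - 2 * r * (u1 * (c * (1 - 2 * z * z) - s * (2 * z * k) - c)
               + u2 * (s * (1 - 2 * z * z) + c * (2 * z * k) - s))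
    + r ^ 2 * (u1 * u1 + u2 * u2) - r ^ 2); [ring|].
  rewrite Hu.
  transitivity (4 * (z * z) * (z * z + k * k) * (s * s + c * c)
     - 2 * r * (u1 * (c * (1 - 2 * z * z) - s * (2 * z * k) - c)
               + u2 * (s * (1 - 2 * z * z) + c * (2 * z * k) - s)));
     [ring|].
  rewrite T, T'; ring.
Qed.

(** If the disc of radius [r] avoids the arc up to the angle [2 h], so does the
    disc of radius one with the same tangent.  Near the touching point the term
    in [B] dominates, so it must have the right sign on the side on which the
    arc extends; this sign does not depend on the radius, and the remaining term
    [1 + A] is nonnegative. *)
Lemma power_of_unit_disc (r A B h : R) :
  0 < r <= 1 -> -1 <= A <= 1 -> - (PI / 4) <= h <= PI / 4 ->
  (forall l, 0 < l <= 1 ->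
     0 <= sin (l * h) * (sin (l * h) * (1 + r * A) - r * B * cos (l * h))) ->
  0 <= sin h * (sin h * (1 + A) - B * cos h).
Proof.
  (* The expression is invariant under [(h, B) -> (- h, - B)], and zero at
     [h = 0], so it is enough to treat [0 < h]. *)
  assert (Hpos : forall B h, 0 < r <= 1 -> -1 <= A <= 1 -> 0 < h <= PI / 4 ->
    (forall l, 0 < l <= 1 ->
     0 <= sin (l * h) * (sin (l * h) * (1 + r * A) - r * B * cos (l * h))) ->
    0 <= sin h * (sin h * (1 + A) - B * cos h)).
  { clear B h; intros B h Hr HA Hh Hl.
    pose proof PI_RGT_0.
    assert (Hsin : 0 < sin h) by (apply sin_gt_0; lra).
    assert (Hcos : 0 < cos h) by (apply cos_gt_0; lra).
    destruct (Rle_dec B 0) as [HB|HB].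
    { apply Rmult_le_pos; [lra|nra]. }
    exfalso.
    assert (HrB : 0 < r * B) by nra.
    (* At [y], [sin y (1 + r A) <= 2 y] is at most half of [r B cos h]. *)
    set (y := Rmin h (r * B * cos h / 4)).
    assert (Hy0 : 0 < y).
    { apply Rmin_glb_lt; [lra|].
      apply Rdiv_lt_0_compat; [apply Rmult_lt_0_compat; lra|lra]. }
    assert (Hyh : y <= h) by apply Rmin_l.
    assert (Hyb : y <= r * B * cos h / 4) by apply Rmin_r.
    specialize (Hl (y / h)).
    replace (y / h * h) with y in Hl by (field; lra).
    assert (Hs : 0 < sin y) by (apply sin_gt_0; lra).
    assert (Hsy : sin y < y) by (apply sin_lt_x; lra).
    assert (Hc : cos h <= cos y) by (apply cos_decr_1; lra).
    assert (Hyh' : 0 < y / h <= 1).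
    { split; [apply Rdiv_lt_0_compat; lra|apply Rle_div_l; lra]. }
    specialize (Hl Hyh').
    assert (HrA : 0 <= 1 + r * A <= 2) by (split; nra).
    assert (H1 : sin y * (1 + r * A) <= y * 2)
      by (apply Rmult_le_compat; lra).
    assert (H2 : r * B * cos h <= r * B * cos y)
      by (apply Rmult_le_compat_l; lra).
    assert (H3 : 0 < r * B * cos h) by (apply Rmult_lt_0_compat; lra).
    assert (H4 : sin y * (1 + r * A) - r * B * cos y < 0) by lra.
    clear - Hl Hs H4; nra. }
  intros Hr HA Hh Hl.
  destruct (Rtotal_order h 0) as [Hneg|[->|Hp]].
  - replace (sin h * (sin h * (1 + A) - B * cos h))
      with (sin (- h) * (sin (- h) * (1 + A) - - B * cos (- h)))
      by (rewrite sin_neg, cos_neg; ring).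
    apply Hpos; try lra.
    intros l Hl'; specialize (Hl l Hl').
    replace (l * - h) with (- (l * h)) by ring.
    rewrite sin_neg, cos_neg; lra.
  - rewrite sin_0; lra.
  - apply Hpos; auto; lra.
Qed.

(** A touching disc of radius [r < 1] can be blown up about the touching point
    to a disc of radius one which still avoids the arc, so it is not maximal;
    and no point of the arc is closer to the centre of a touching disc than its
    radius.  For arcs longer than half a turn this would fail: the disc with the
    chord between the two ends as diameter would be maximal. *)
Lemma medial_axis_short_arc a b c :
  a < b <= a + 1 / 4 -> medial_axis (arc unit_circle a b) c ->
  forall s, a <= s <= b -> 1 <= dist (unit_circle s) c.
Proof.
  intros Hab (r & (Hr & (p & (s0 & Hs0 & <-) & Hp) & Hfree) & Hmax) s Hs.
  apply Rnot_lt_le; intros Hlt.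
  assert (Hr1 : r < 1).
  { apply Rle_lt_trans with (dist (unit_circle s) c); [|assumption].
    apply Rnot_lt_le, Hfree; now exists s. }
  pose proof PI_RGT_0 as HPI.
  set (p := unit_circle s0) in *.
  set (u := ((fst c - fst p) / r, (snd c - snd p) / r) : plane).
  assert (Hu : dot u u = 1).
  { pose proof (dist_sqr p c) as E; rewrite Hp, minus_coord in E.
    unfold dot, u in *; cbn [fst snd] in *.
    apply (Rmult_eq_reg_l (r ^ 2)); [|nra].
    rewrite Rmult_1_r; etransitivity; [|symmetry; exact E]; field; lra. }
  set (cc := fun q => (fst p + q * fst u, snd p + q * snd u) : plane).
  assert (Ec : cc r = c).
  { unfold cc, u; apply plane_eq; cbn [fst snd]; field; lra. }
  set (A := dot u p); set (B := cross p u).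
  assert (Hpow : forall q t,
    dot (minus (unit_circle t) (cc q)) (minus (unit_circle t) (cc q)) - q ^ 2
    = 4 * (sin (PI * (t - s0)) * (sin (PI * (t - s0)) * (1 + q * A)
           - q * B * cos (PI * (t - s0))))).
  { intros q t.
    pose proof (disc_power (2 * PI * s0) (PI * (t - s0)) q u Hu) as E.
    cbv zeta in E.
    replace (2 * PI * s0 + 2 * (PI * (t - s0))) with (2 * PI * t) in E by ring.
    exact E. }
  assert (HA : -1 <= A <= 1).
  { assert (A ^ 2 + B ^ 2 = 1).
    { transitivity (dot u u * dot p p);
        [unfold A, B, dot, cross; ring|].
      rewrite Hu, <- (norm_sqr p); unfold p, unit_circle.
      rewrite norm_angle_point; ring. }
    nra. }
  assert (Hunit : forall t, a <= t <= b -> 1 <= dist (unit_circle t) (cc 1)).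
  { intros t Ht.
    apply Rsqr_incr_0_var; [|apply dist_ge0].
    rewrite !Rsqr_pow2, dist_sqr.
    enough (0 <= sin (PI * (t - s0)) * (sin (PI * (t - s0)) * (1 + A)
              - B * cos (PI * (t - s0)))) as H.
    { specialize (Hpow 1 t); rewrite !Rmult_1_l in Hpow; lra. }
    apply (power_of_unit_disc r); auto; try lra.
    { split; nra. }
    intros l Hl.
    replace (l * (PI * (t - s0))) with (PI * (s0 + l * (t - s0) - s0)) by ring.
    set (t' := s0 + l * (t - s0)).
    assert (Ht' : a <= t' <= b) by (unfold t'; split; nra).
    specialize (Hpow r t'); rewrite Ec in Hpow.
    assert (Hd : r <= dist (unit_circle t') c).
    { apply Rnot_lt_le, Hfree; now exists t'. }
    assert (r ^ 2 <= dist (unit_circle t') c ^ 2) by (apply pow_incr; lra).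
    rewrite dist_sqr in *; lra. }
  destruct (Hmax (cc 1) 1) as [_ E]; [| |lra].
  - split; [lra|split].
    + exists p; split; [now exists s0|].
      apply Rsqr_inj; [apply dist_ge0|lra|].
      rewrite !Rsqr_pow2, dist_sqr, minus_coord.
      transitivity (dot u u); [|rewrite Hu; ring].
      unfold cc, dot; cbn [fst snd]; ring.
    + intros q (t & Ht & <-); apply Rle_not_lt, Hunit, Ht.
  - intros x Hx.
    apply Rle_lt_trans with (1 := dist_triangle x c (cc 1)).
    enough (dist c (cc 1) = 1 - r) by lra.
    apply Rsqr_inj; [apply dist_ge0|lra|].
    rewrite !Rsqr_pow2, dist_sqr, minus_coord, <- Ec.
    transitivity ((1 - r) ^ 2 * dot u u); [|rewrite Hu; ring].
    unfold cc, dot; cbn [fst snd]; ring.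
Qed.

Lemma unit_circle_separation : covering_separation_bound unit_circle.
Proof.
  exists (fun a b => a < b <= a + 1 / 4); split.
  - intros a b Hab; split; [lra|split].
    + intros s s' Hs Hs' E.
      destruct (unit_circle_injective s s' E) as [k Hk].
      assert (-1 < IZR k < 1) as [H1 H2] by lra.
      apply lt_IZR in H1; apply lt_IZR in H2.
      assert (k = 0)%Z as -> by lia; lra.
    + intros c Hc; now apply medial_axis_short_arc.
  - intros s; exists s, (s + 1 / 4), s; split; [lra|split; [|lra]].
    exists 0%Z; lra.
Qed.

Lemma unit_circle_ribbon : embedded_ribbon_loop unit_circle.
Proof.
  split; [|split].
  - split; [exact unit_circle_loop|exact unit_circle_injective].
  - exact unit_circle_separation.
  - exact unit_circle_crossing.
Qed.

Lemma length_unit_circle : length unit_circle = 2 * PI.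
Proof. apply length_const_speed, unit_circle_speed. Qed.

Theorem mainTheorem5 :
  (exists g : R -> plane, embedded_ribbon_loop g /\ Rib g = PI) /\
  (forall g : R -> plane, embedded_ribbon_loop g -> PI <= Rib g) /\
  (forall g : R -> plane, embedded_ribbon_loop g ->
     (forall h : R -> plane, embedded_ribbon_loop h -> length g <= length h) ->
     length g = 2 * PI).
Proof.
  assert (Hlower : forall g, embedded_ribbon_loop g -> 2 * PI <= length g).
  { intros g ([Hloop _] & _ & Hcross); now apply loop_length_ge. }
  split; [|split].
  - exists unit_circle; split; [exact unit_circle_ribbon|].
    unfold Rib; rewrite length_unit_circle; field.
  - intros g Hg; unfold Rib; specialize (Hlower g Hg); lra.
  - intros g Hg Hmin; apply Rle_antisym; [|now apply Hlower].
    rewrite <- length_unit_circle; apply Hmin, unit_circle_ribbon.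
Qed.
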